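(* For every integer $k>2$, $$\sqrt[2k]{2}\leq \lim_{n\to\infty}\zeta_k(n) \leq \sqrt[k+1]{2}.$$
   Context: All graphs are finite and simple. For a positive integer $k$, a $k$-dominating independent set ($k$-DIS) of a graph $G$ is a set $D\subseteq V(G)$ that induces no edge and such that every vertex $v\in V(G)\setminus D$ satisfies $|N(v)\cap D|\geq k$, where $N(v)$ is the set of neighbors of $v$. Let $\mathrm{mi}_k(n)$ denote the maximum number of $k$-DISes in a graph on $n$ vertices, and let $\zeta_k(n):=\sqrt[n]{\mathrm{mi}_k(n)}$. The limit $\lim_{n\to\infty}\zeta_k(n)$ exists for every $k$. *)

(* Defs.v *)
From HB Require Import structures.
From mathcomp Require Import all_boot all_order all_algebra.
From mathcomp Require Import all_classical all_reals all_analysis.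
Import Order.TTheory GRing.Theory Num.Theory.
Import numFieldNormedType.Exports.

Set Implicit Arguments.
Unset Strict Implicit.
Unset Printing Implicit Defensive.

Definition simple_graph (T : finType) (adj : rel T) : bool :=
  [forall x, ~~ adj x x] && [forall x, forall y, adj x y == adj y x].

Definition neighbors (T : finType) (adj : rel T) (v : T) : {set T} :=
  [set u | adj v u]%SET.

Definition independent (T : finType) (adj : rel T) (D : {set T}) : bool :=
  [forall x in D, forall y in D, ~~ adj x y].

Definition kDIS (T : finType) (adj : rel T) (k : nat) (D : {set T}) : bool :=
  independent adj D &&
  [forall v, (v \notin D) ==> (k <= #|neighbors adj v :&: D|)%N].

Definition num_kDIS (T : finType) (adj : rel T) (k : nat) : nat :=
  #|[set D : {set T} | kDIS adj k D]%SET|.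

(* Up to isomorphism the vertex set is 'I_n; a graph on it is given by its
   adjacency relation, stored as a set of ordered pairs so that graphs range
   over a finite type. *)
Definition adj_of (n : nat) (E : {set 'I_n * 'I_n}) : rel 'I_n :=
  fun x y => (x, y) \in E.

Definition mi (k n : nat) : nat :=
  \max_(E : {set 'I_n * 'I_n} | simple_graph (adj_of E)) num_kDIS (adj_of E) k.

Local Open Scope ring_scope.

(* The real n-th root of x, for x >= 0 and n > 0; for n = 0 the exponent is
   0^-1 = 0, so the value is 1, which is irrelevant to limits in n. *)
Definition real_root (R : realType) (n : nat) (x : R) : R := x `^ (n%:R^-1).

Definition zeta (R : realType) (k n : nat) : R := real_root n (mi k n)%:R.

(* Main.v *)
Require Import Defs.
From mathcomp Require Import all_boot all_order all_algebra.
From mathcomp Require Import zify ring lra.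
From mathcomp Require Import all_classical all_reals all_analysis.
Import Order.TTheory GRing.Theory Num.Theory.
Import numFieldNormedType.Exports.

(** The limit exists because the disjoint union of two graphs multiplies their
numbers of k-DISes ([mi_supermultiplicative]), so that ln (mi k n) is
superadditive and Fekete's lemma ([fekete]) applies; the limit is then the
supremum of all zeta k n with n > 0, and any single graph gives a lower
bound. The complete bipartite graph K_{k,k} has 2k vertices, and both of its
sides are k-DISes ([mi_biclique]), whence the lower bound.

The upper bound is the inequality mi k n ^ (k+1) <= 2 ^ n ([mi_bound]), an
induction on the number of vertices. Write P for the number of k-DISes of a
graph, P_u for the number of those containing u, and let v be a vertex of
minimum degree d. A k-DIS containing u is determined by its trace outside the
closed neighborhood N[u], and this trace is a k-DIS of what remains
([card_kDIS_in_through]); so each P_u is bounded by the count for a graph with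
at least d+1 vertices fewer. If d < k, the vertex v cannot be dominated and
lies in every k-DIS, so P = P_v. If d >= k, a k-DIS avoiding v contains at
least k neighbors of v, and double counting ([kDIS_in_double_count]) gives
  k P <= k P_v + sum_(u in N(v)) P_u <= (k + d) max_u P_u.
The induction therefore closes as soon as (1 + d/k) ^ (k+1) <= 2 ^ (d+1), which
is [addn_expn_le]. There d = k is an equality, and passing from d to d+1
multiplies the left side by (1 + 1/(k+d)) ^ (k+1) <= 2, an
estimate valid for k > 2 and d >= k ([succ_expn_le_double]). *)

Set Implicit Arguments.
Unset Strict Implicit.
Unset Printing Implicit Defensive.

(** * Counting k-dominating independent sets of induced subgraphs *)

Section InducedSubgraphs.
Local Open Scope nat_scope.

Lemma simple_graph_sym (T : finType) (adj : rel T) :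
  simple_graph adj -> symmetric adj.
Proof. by move=> /andP[_ /forallP h] x y; apply/eqP; move/forallP: (h x). Qed.

Lemma simple_graph_irr (T : finType) (adj : rel T) :
  simple_graph adj -> irreflexive adj.
Proof. by move=> /andP[/forallP h _] x; apply/negbTE. Qed.

Lemma independentP (T : finType) (adj : rel T) (D : {set T}) :
  reflect {in D &, forall x y, ~~ adj x y} (independent adj D).
Proof.
apply: (iffP forall_inP) => [h x y xD yD|h x xD].
  by move/forall_inP: (h x xD); apply.
by apply/forall_inP => y yD; apply: h.
Qed.

(** The k-DISes of the subgraph induced on S. Working with vertex subsets of a
fixed graph keeps the induction free of changes of vertex type; intersecting
neighborhoods with D, a subset of S, makes a restriction of the adjacency
relation superfluous. *)
Definition kDIS_in (T : finType) (adj : rel T) (k : nat) (S : {set T}) :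
    {set {set T}} :=
  [set D : {set T} | [&& D \subset S, independent adj D &
     [forall v in S :\: D, k <= #|neighbors adj v :&: D|]]]%SET.

Lemma card_kDIS_in_setT (T : finType) (adj : rel T) (k : nat) :
  #|kDIS_in adj k [set: T]%SET| = num_kDIS adj k.
Proof.
apply: eq_card => D; rewrite !inE finset.subsetT /kDIS /=; congr (_ && _).
by apply: eq_forallb => v; rewrite !inE andbT.
Qed.

Definition closed_nbhd (T : finType) (adj : rel T) (u : T) : {set T} :=
  (u |: neighbors adj u)%SET.

(** Removing u from a k-DIS D through u gives a k-DIS of the graph without
N[u]: D meets N[u] only in u by independence, and a vertex outside N[u] is not
adjacent to u, so it loses none of its neighbors in D. *)
Lemma card_kDIS_in_through (T : finType) (adj : rel T) (k : nat)
    (S : {set T}) (u : T) : simple_graph adj ->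
  #|[set D in kDIS_in adj k S | u \in D]%SET|
    <= #|kDIS_in adj k (S :\: closed_nbhd adj u)%SET|.
Proof.
move=> G; have sym := simple_graph_sym G.
rewrite -(@card_in_imset _ _ (fun D : {set T} => (D :\ u)%SET)); last first.
  move=> D D'; rewrite !inE => /andP[_ uD] /andP[_ uD'] e.
  by rewrite -(finset.setD1K uD) e finset.setD1K.
apply/subset_leq_card/fintype.subsetP => _ /imsetP[D + ->].
rewrite !inE => /andP[/and3P[/fintype.subsetP DS]].
move=> /independentP ind /forall_inP dom uD.
apply/and3P; split.
- apply/fintype.subsetP => x; rewrite !inE => /andP[xu xD].
  by rewrite (negbTE xu) /= ind //= DS.
- apply/independentP => x y; rewrite !inE => /andP[_ xD] /andP[_ yD].
  exact: ind.
apply/forall_inP => w; rewrite !inE negb_and negbK negb_or.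
case/and3P => wD /andP[wu wNu] wS.
have {}wD : w \notin D by rewrite (negbTE wu) in wD.
apply: leq_trans (dom w _) _; first by rewrite inE wD.
apply/subset_leq_card/fintype.subsetP => x; rewrite !inE => /andP[wx xD].
by rewrite wx xD !andbT; apply: contraNneq wNu => <-; rewrite sym.
Qed.

(** Each k-DIS contributes at least k on the right: through the first term if
it contains v, and through k of its neighbors of v otherwise. *)
Lemma kDIS_in_double_count (T : finType) (adj : rel T) (k : nat)
    (S : {set T}) (v : T) : v \in S ->
  k * #|kDIS_in adj k S| <=
    k * #|[set D in kDIS_in adj k S | v \in D]%SET| +
    \sum_(u in (neighbors adj v :&: S)%SET)
      #|[set D in kDIS_in adj k S | u \in D]%SET|.
Proof.
move=> vS; set P := kDIS_in _ _ _.
have through u : #|[set D in P | u \in D]%SET| = \sum_(D in P) (u \in D).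
  rewrite -sum1_card (eq_bigl (fun D => (D \in P) && (u \in D))); last first.
    by move=> D; rewrite inE.
  by rewrite big_mkcondr; apply: eq_bigr => D _; case: (u \in D).
rewrite through (eq_bigr _ (fun u _ => through u)) exchange_big /=.
rewrite big_distrr /= -big_split /= mulnC -sum_nat_const.
apply: leq_sum => D; rewrite inE => /and3P[/fintype.subsetP DS _].
move=> /forall_inP dom.
case: (boolP (v \in D)) => vD; first by rewrite muln1 leq_addr.
rewrite muln0 add0n; apply: leq_trans (dom v _) _; first by rewrite inE vD.
rewrite -sum1_card big_mkcond [leqRHS]big_mkcond; apply: leq_sum => u _.
rewrite !inE; case: (boolP (u \in D)) => uD; last by rewrite andbF.
by rewrite (DS _ uD) !andbT; case: ifP.
Qed.

End InducedSubgraphs.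

(** * The numerical inequality behind the upper bound *)

Section Numeric.
Local Open Scope nat_scope.

(** Bernoulli's inequality 1 - a y <= (1 - y)^a at y = 1/(m+1), with
denominators cleared; truncated subtraction covers a > m. *)
Lemma bernoulli_nat (m a : nat) :
  (m.+1 - a) * m.+1 ^ a <= m ^ a * m.+1.
Proof.
elim: a => [|a IH]; first by rewrite subn0 muln1 mul1n.
have step : (m.+1 - a.+1) * m.+1 <= m * (m.+1 - a) by nia.
rewrite !expnS mulnA -[m * m ^ a * _]mulnA.
apply: (@leq_trans (m * ((m.+1 - a) * m.+1 ^ a))); last first.
  by rewrite leq_mul2l IH orbT.
by rewrite [leqRHS]mulnA leq_mul2r step orbT.
Qed.

(** With y = 1/(m+1), the claim is (1 - y)^(k+1) >= 1/2. Bernoulli's inequality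
for the whole exponent gives 1 - (k+1) y, which is below 1/2 for m = 2k. Applied
to the two halves a, b of k+1 it gives (1 - a y)(1 - b y), and the extra
second-order term suffices when k > 2. *)
Lemma succ_expn_le_double (k m : nat) :
  2 < k -> k.*2 <= m -> m.+1 ^ k.+1 <= 2 * m ^ k.+1.
Proof.
move=> hk hm.
pose a := k.+1./2; pose b := k.+1 - a.
have kab : k.+1 = a + b by rewrite /a /b; lia.
have balanced : m.+1 * m.+1 <= 2 * ((m.+1 - a) * (m.+1 - b)).
  by rewrite /b /a; have := odd_double_half k.+1; case: (odd _) => /= h; nia.
have cpos : 0 < (m.+1 - a) * (m.+1 - b) by rewrite muln_gt0; lia.
rewrite -(leq_pmul2l cpos) kab !expnD mulnACA.
apply: leq_trans (leq_mul (bernoulli_nat m a) (bernoulli_nat m b)) _.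
rewrite mulnACA [leqLHS]mulnC [leqRHS]mulnCA [leqRHS]mulnA.
by rewrite leq_mul2r balanced orbT.
Qed.
End Numeric.

(** * The upper bound on the number of k-dominating independent sets *)

Section UpperBound.
Local Open Scope nat_scope.

(** The inequality 1 + d/k <= 2^((d+1)/(k+1)) with denominators cleared: it
makes the branching on a vertex of degree d no worse than the one for d = k,
where k+1 vertices are removed and the count doubles. *)
Lemma addn_expn_le (k d : nat) : 2 < k -> k <= d ->
  (k + d) ^ k.+1 <= 2 ^ d.+1 * k ^ k.+1.
Proof.
move=> hk; elim: d => [|d IH]; first by move: hk; case: k.
rewrite leq_eqVlt => /predU1P[<-|kd].
  by rewrite addnn -mul2n expnMn.
rewrite addnS [2 ^ d.+2]expnS -mulnA.
apply: leq_trans (succ_expn_le_double hk _) _.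
  by rewrite -addnn leq_add2l.
by rewrite leq_mul2l IH.
Qed.

(** The bound count <= 2^(#|S|/(k+1)), raised to the power k+1 so that the
induction stays in the natural numbers. It branches on a vertex of minimum
degree in the induced subgraph: minimality ensures that discarding N[u] costs
at least as many vertices for each neighbor u as for v itself. *)
Lemma kDIS_in_bound (T : finType) (adj : rel T) (k : nat) (S : {set T}) :
  2 < k -> simple_graph adj -> #|kDIS_in adj k S| ^ k.+1 <= 2 ^ #|S|.
Proof.
move=> hk G; have sym := simple_graph_sym G; have irr := simple_graph_irr G.
have [n] := ubnP #|S|; elim: n S => // n IH S; rewrite ltnS => Sn.
have [->|[v0 v0S]] := set_0Vmem S.
  have le1 : #|kDIS_in adj k (finset.set0 : {set T})| <= 1.
    rewrite -(cards1 (finset.set0 : {set T})).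
    apply/subset_leq_card/fintype.subsetP => D.
    by rewrite !inE finset.subset0 => /and3P[].
  apply: (@leq_trans (1 ^ k.+1)); first by rewrite leq_exp2r.
  by rewrite exp1n expn_gt0.
pose deg v := #|(neighbors adj v :&: S)%SET|.
have [v vS vmin] := arg_minnP deg v0S.
have branch u : u \in S ->
    #|[set D in kDIS_in adj k S | u \in D]%SET| ^ k.+1 * 2 ^ (deg v).+1
      <= 2 ^ #|S|.
  move=> uS.
  have cN : #|(S :&: closed_nbhd adj u)%SET| = (deg u).+1.
    rewrite /deg finset.setIC /closed_nbhd finset.setIUl.
    have -> : ([set u] :&: S = [set u])%SET.
      by apply/finset.setIidPl; rewrite finset.sub1set.
    by rewrite cardsU1 !inE irr.
  have cS := cardsID (closed_nbhd adj u) S; rewrite cN in cS.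
  have lt : #|(S :\: closed_nbhd adj u)%SET| < n by lia.
  apply: (@leq_trans (2 ^ #|(S :\: closed_nbhd adj u)%SET| * 2 ^ (deg u).+1)).
    rewrite leq_mul // ?leq_pexp2l ?ltnS ?vmin //.
    by apply: leq_trans (IH _ lt); rewrite leq_exp2r // card_kDIS_in_through.
  by rewrite -expnD addnC cS.
have [dk|kd] := ltnP (deg v) k.
  (* v has fewer than k neighbors, so it must belong to every k-DIS. *)
  have -> : kDIS_in adj k S = [set D in kDIS_in adj k S | v \in D]%SET.
    apply/setP => D; rewrite [RHS]inE; apply/idP/andP => [DP|[]//]; split=> //.
    move: DP; rewrite inE => /and3P[DS _ /forall_inP dom].
    apply: contraLR dk => vD; rewrite -leqNgt.
    apply: leq_trans (dom v _) _; first by rewrite inE vD.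
    exact/subset_leq_card/finset.setIS.
  by apply: leq_trans (branch v vS); rewrite leq_pmulr // expn_gt0.
(* Maximizing over all of S is harmless, as branch holds at every vertex. *)
pose p u := #|[set D in kDIS_in adj k S | u \in D]%SET|.
have [u uS pmax] := arg_maxnP p vS.
have count : k * #|kDIS_in adj k S| <= (k + deg v) * p u.
  apply: leq_trans (kDIS_in_double_count adj k vS) _.
  rewrite mulnDl; apply: leq_add; first by rewrite leq_mul //; apply: pmax.
  apply: (@leq_trans (\sum_(w in (neighbors adj v :&: S)%SET) p u)).
    by apply: leq_sum => w; rewrite inE => /andP[_ wS]; apply: pmax.
  by rewrite sum_nat_const.
have kpos : 0 < k ^ k.+1 by rewrite expn_gt0 (leq_trans _ hk).
rewrite -(leq_pmul2l kpos) -expnMn.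
apply: leq_trans (_ : ((k + deg v) * p u) ^ k.+1 <= _).
  by rewrite leq_exp2r.
rewrite expnMn; apply: leq_trans (leq_mul (addn_expn_le hk kd) (leqnn _)) _.
by rewrite [_ ^ _ * k ^ _]mulnC -mulnA leq_mul2l mulnC branch ?orbT.
Qed.

Lemma num_kDIS_bound (T : finType) (adj : rel T) (k : nat) :
  2 < k -> simple_graph adj -> num_kDIS adj k ^ k.+1 <= 2 ^ #|T|.
Proof.
by move=> hk G; rewrite -card_kDIS_in_setT -cardsT; apply: kDIS_in_bound.
Qed.

Lemma mi_attained (k n : nat) :
  exists2 E, simple_graph (@adj_of n E) & mi k n = num_kDIS (@adj_of n E) k.
Proof.
have G0 : simple_graph (@adj_of n finset.set0).
  apply/andP; split; first by apply/forallP => x; rewrite /adj_of inE.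
  by apply/forallP => x; apply/forallP => y; rewrite /adj_of !inE.
have h : 0 < #|[pred E | simple_graph (@adj_of n E)]|.
  by apply/card_gt0P; exists finset.set0.
have [E GE e] := eq_bigmax_cond (fun E => num_kDIS (@adj_of n E) k) h.
by exists E.
Qed.

Lemma mi_bound (k n : nat) : 2 < k -> mi k n ^ k.+1 <= 2 ^ n.
Proof.
move=> hk; have [E G ->] := mi_attained k n.
by rewrite -[X in _ <= 2 ^ X]card_ord; apply: num_kDIS_bound.
Qed.
End UpperBound.

(** * Lower bounds: disjoint unions and complete bipartite graphs *)

Section LowerBound.
Local Open Scope nat_scope.

(** The maximum ranges over graphs on ordinals only; transport along
[enum_rank] lets the extremal examples live on their natural vertex types. *)
Lemma num_kDIS_le_mi (T : finType) (adj : rel T) (k : nat) :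
  simple_graph adj -> num_kDIS adj k <= mi k #|T|.
Proof.
move=> G.
pose E := [set p : 'I_#|T| * 'I_#|T| | adj (enum_val p.1) (enum_val p.2)]%SET.
have adjE x y : adj_of E (enum_rank x) (enum_rank y) = adj x y.
  by rewrite /adj_of inE /= !enum_rankK.
have GE : simple_graph (adj_of E).
  apply/andP; split; apply/forallP => x; rewrite -(enum_valK x).
    by rewrite adjE (simple_graph_irr G).
  apply/forallP => y; rewrite -(enum_valK y).
  by rewrite !adjE (simple_graph_sym G).
apply: (@leq_trans (num_kDIS (adj_of E) k)); last first.
  by rewrite /mi (bigD1 E) //= leq_maxl.
have inj : injective (@enum_rank T) := enum_rank_inj.
rewrite /num_kDIS -(card_imset _ (imset_inj inj)).
apply/subset_leq_card/fintype.subsetP => _ /imsetP[D + ->].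
rewrite !inE => /andP[/independentP ind /forallP dom]; apply/andP; split.
  apply/independentP => _ _ /imsetP[x xD ->] /imsetP[y yD ->].
  by rewrite adjE ind.
apply/forallP => w; rewrite -(enum_valK w) mem_imset //.
apply/implyP => wD; apply: leq_trans (implyP (dom _) wD) _.
rewrite -(card_imset _ inj); apply/subset_leq_card/fintype.subsetP.
move=> _ /imsetP[x + ->]; rewrite !inE adjE => /andP[-> xD].
by rewrite mem_imset.
Qed.

Definition sum_rel (T1 T2 : finType) (e1 : rel T1) (e2 : rel T2) :
    rel (T1 + T2) :=
  fun x y => match x, y with
    | inl a, inl b => e1 a b | inr a, inr b => e2 a b | _, _ => false end.

(** The union of a k-DIS of each component is a k-DIS of the disjoint union,
and it determines both of them. *)
Lemma num_kDIS_sum (T1 T2 : finType) (e1 : rel T1) (e2 : rel T2) (k : nat) :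
  num_kDIS e1 k * num_kDIS e2 k <= num_kDIS (sum_rel e1 e2) k.
Proof.
pose join (p : {set T1} * {set T2}) : {set T1 + T2} :=
  [set x | match x with inl a => a \in p.1 | inr b => b \in p.2 end]%SET.
have jinj : injective join.
  move=> [A B] [A' B'] /setP e; congr (_, _); apply/setP => x.
    by have := e (inl x); rewrite !inE.
  by have := e (inr x); rewrite !inE.
rewrite /num_kDIS -cardsX -(card_imset _ jinj).
apply/subset_leq_card/fintype.subsetP => _ /imsetP[[A B] + ->].
rewrite !inE /= => /andP[/andP[/independentP indA /forallP domA]].
move=> /andP[/independentP indB /forallP domB]; apply/andP; split.
  by apply/independentP => -[a|b] [a'|b']; rewrite !inE /=; auto.
apply/forallP => -[a|b]; apply/implyP; rewrite inE /= => nx.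
  apply: leq_trans (implyP (domA a) nx) _.
  rewrite -(card_imset _ (@inl_inj T1 T2)).
  apply/subset_leq_card/fintype.subsetP => _ /imsetP[x + ->].
  by rewrite !inE.
apply: leq_trans (implyP (domB b) nx) _.
rewrite -(card_imset _ (@inr_inj T1 T2)).
apply/subset_leq_card/fintype.subsetP => _ /imsetP[x + ->].
by rewrite !inE.
Qed.

Lemma simple_graph_sum (T1 T2 : finType) (e1 : rel T1) (e2 : rel T2) :
  simple_graph e1 -> simple_graph e2 -> simple_graph (sum_rel e1 e2).
Proof.
move=> G1 G2; apply/andP; split; apply/forallP => -[a|b] /=.
- by rewrite (simple_graph_irr G1).
- by rewrite (simple_graph_irr G2).
- by apply/forallP => -[a'|b'] //=; rewrite (simple_graph_sym G1).
- by apply/forallP => -[a'|b'] //=; rewrite (simple_graph_sym G2).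
Qed.

Lemma mi_supermultiplicative (k m n : nat) : mi k m * mi k n <= mi k (m + n).
Proof.
have [E G ->] := mi_attained k m; have [E' G' ->] := mi_attained k n.
apply: leq_trans (num_kDIS_sum _ _ _) _.
rewrite -[in mi k (m + n)](card_ord m) -[in mi k (_ + n)](card_ord n) -card_sum.
exact/num_kDIS_le_mi/simple_graph_sum.
Qed.

Lemma mi_gt0 (k n : nat) : 0 < mi k n.
Proof.
pose adj : rel 'I_n := fun _ _ => false.
have G : simple_graph adj.
  by apply/andP; split; apply/forallP => // x; apply/forallP.
rewrite -[n]card_ord; apply: leq_trans _ (num_kDIS_le_mi k G).
apply/card_gt0P; exists [set: 'I_n]%SET; rewrite inE; apply/andP; split.
  exact/independentP.
by apply/forallP => v; rewrite inE.
Qed.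

Lemma mi_biclique (k : nat) : 0 < k -> 2 <= mi k (2 * k).
Proof.
move=> k0; pose adj : rel (bool * 'I_k) := fun x y => x.1 != y.1.
have G : simple_graph adj.
  apply/andP; split; apply/forallP => x; first by rewrite /adj eqxx.
  by apply/forallP => y; apply/eqP; rewrite /adj eq_sym.
have -> : 2 * k = #|{: bool * 'I_k}| by rewrite card_prod card_bool card_ord.
apply: leq_trans _ (num_kDIS_le_mi k G).
pose side b := [set x : bool * 'I_k | x.1 == b]%SET.
have side_inj : injective side.
  by move=> b b' /setP /(_ (b, Ordinal k0)); rewrite !inE eqxx => /esym/eqP.
rewrite -card_bool -(card_imset _ side_inj).
apply/subset_leq_card/fintype.subsetP => _ /imsetP[b _ ->].
rewrite inE; apply/andP; split.
  apply/independentP => x y; rewrite !inE => /eqP xb /eqP yb.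
  by rewrite /adj xb yb eqxx.
apply/forallP => v; apply/implyP; rewrite inE => vb.
have pinj : injective (pair b : 'I_k -> bool * 'I_k) by move=> i j [].
rewrite -[X in X <= _]card_ord -(card_imset _ pinj).
apply/subset_leq_card/fintype.subsetP => _ /imsetP[i _ ->].
by rewrite !inE /adj /= vb eqxx.
Qed.
End LowerBound.

(** * Existence of the limit *)

Section Limit.
Local Open Scope classical_set_scope.
Local Open Scope ring_scope.

(** The limit is the supremum of the quotients. Writing n = q m + r with r < m,
superadditivity gives a_n >= q a_m, and q m > n - m turns this into
a_n / n >= a_m / m - a_m / n, whose error term vanishes as n grows. The bound
a_n <= n c keeps the supremum finite. At n = 0 the quotient is 0, which
leaves the supremum unchanged because the sequence is nonnegative. *)
Lemma fekete (R : realType) (a : nat -> R) (c : R) :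
    (forall n, 0 <= a n) -> (forall m n, a m + a n <= a (m + n)%N) ->
    (forall n, a n <= n%:R * c) ->
  exists L, [/\ (fun n => a n / n%:R) @ \oo --> L,
    (forall n, a n / n%:R <= L) & L <= c].
Proof.
move=> a0 aD ac.
have ub n : a n / n%:R <= c.
  case: n => [|n]; last by rewrite ler_pdivrMr ?ltr0n // mulrC ac.
  rewrite invr0 mulr0; apply: le_trans (a0 1%N) _.
  by rewrite (le_trans (ac _)) // mul1r.
have bnd : has_sup (range (fun n => a n / n%:R)).
  split; first by exists (a 0%N / 0%:R); exists 0%N.
  by exists c => _ [n _ <-].
pose L := sup (range (fun n => a n / n%:R)).
have leL n : a n / n%:R <= L by apply: sup_upper_bound => //; exists n.
exists L; split=> //; last by apply: ge_sup => [|_ [n _ <-]]; [case: bnd|].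
have aM m q : q%:R * a m <= a (q * m)%N.
  elim: q => [|q IH]; first by rewrite mul0r a0.
  by rewrite -natr1 mulrDl mul1r mulSn addnC (le_trans _ (aD _ _)) // lerD2r.
have lower m n : (0 < n)%N -> a m / m%:R - a m / n%:R <= a n / n%:R.
  move=> n0; case: (posnP m) => [->|m0].
    by rewrite invr0 mulr0 sub0r (@le_trans _ _ 0) ?oppr_le0 ?divr_ge0.
  have q1 : n%:R <= ((n %/ m)%:R + 1) * m%:R :> R.
    by rewrite natr1 -natrM ler_nat ltnW // ltn_ceil.
  have q2 : (n %/ m)%:R * a m <= a n.
    rewrite [in leRHS](divn_eq n m).
    by rewrite (le_trans (aM _ _)) // (le_trans _ (aD _ _)) // lerDl a0.
  have nR : 0 < n%:R :> R by rewrite ltr0n.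
  have mR : 0 < m%:R :> R by rewrite ltr0n.
  rewrite ler_pdivlMr // mulrBl divfK ?lt0r_neq0 //.
  apply: le_trans q2; rewrite lerBlDr -mulrA [_^-1 * _]mulrC mulrA.
  rewrite ler_pdivrMr //.
  have -> : ((n %/ m)%:R * a m + a m) * m%:R
    = a m * (((n %/ m)%:R + 1) * m%:R) by ring.
  by rewrite ler_wpM2l.
apply/cvgrPdist_le => e e0.
have [_ [m _ <-] Lm] := sup_adherent (divr_gt0 e0 (ltr0n R 2)) bnd.
have big := nbhs_infty_gtr (a m / (e / 2)).
near=> n.
have n0 : 0 < n%:R :> R by near: n; exact: nbhs_infty_gtr.
have small : a m / n%:R <= e / 2.
  rewrite ler_pdivrMr // mulrC -ler_pdivrMr ?divr_gt0 //.
  by near: n; apply: filterS big => x /ltW; exact.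
have := lower m n; rewrite -(ltr0n R) => /(_ n0) h.
by rewrite ger0_norm ?subr_ge0 // -/L; move: Lm; rewrite -/L; lra.
Unshelve. all: by end_near. Qed.

Lemma real_root_expR (R : realType) (n : nat) (x : R) :
  0 < x -> real_root n x = expR (ln x / n%:R).
Proof. by move=> x0; rewrite /real_root /powR gt_eqF // mulrC. Qed.

End Limit.

Local Open Scope classical_set_scope.
Local Open Scope ring_scope.

(** Up to the exponential, [zeta] is the sequence ln (mi k n) / n, to which
Fekete's lemma applies. *)
Theorem theorem1p7 (R : realType) (k : nat) (hk : (2 < k)%N) :
  cvgn (zeta R k) /\
  real_root (2 * k)%N (2 : R) <= limn (zeta R k) <= real_root k.+1 (2 : R).
Proof.
have mi0 n : 0 < (mi k n)%:R :> R by rewrite ltr0n mi_gt0.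
pose a n : R := ln (mi k n)%:R.
have a0 n : 0 <= a n by rewrite ln_ge0 // ler1n mi_gt0.
have aD m n : a m + a n <= a (m + n)%N.
  rewrite /a -lnM ?posrE // -natrM ler_ln ?posrE ?ltr0n ?muln_gt0 ?mi_gt0 //.
  by rewrite ler_nat mi_supermultiplicative.
have ac n : a n <= n%:R * (ln 2 / k.+1%:R).
  rewrite mulrA ler_pdivlMr ?ltr0n // !mulr_natr mulr_natl -!lnXn //.
  by rewrite ler_ln ?posrE ?exprn_gt0 // -!natrX ler_nat mi_bound.
have [L [aL leL Lc]] := fekete a0 aD ac.
have zetaE : zeta R k = fun n => expR (a n / n%:R).
  by apply/funext => n; rewrite /zeta real_root_expR.
have zL : zeta R k @ \oo --> expR L.
  by rewrite zetaE; apply: continuous_cvg aL; apply: continuous_expR.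
split; first by apply/cvg_ex; exists (expR L).
rewrite (cvg_lim _ zL) // !real_root_expR // !ler_expR Lc andbT.
apply: le_trans (leL (2 * k)%N).
rewrite ler_wpM2r ?invr_ge0 // /a ler_ln ?posrE //.
by rewrite ler_nat mi_biclique // ltnW // ltnW.
Qed.
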